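(* Let $n\in\mathbb N$, $n\ge1$, and let $S_t$ denote the semigroup of the SEP$(n)$ process. For every density profile $\overline\rho:S\to[0,1]$, every $t>0$, every $k\ge1$ and all $x_1,\dots,x_k\in S$ such that $\sum_{i=1}^k\delta_{x_i}\in\Omega=\{0,1,\dots,n\}^S$ (no site occurs more than $n$ times), $$K_{\nu_{\overline\rho}S_t}(x_1,\dots,x_k)\ \le\ \prod_{i=1}^kK_{\nu_{\overline\rho}S_t}(x_i).$$ In particular, when started from $\nu_{\overline\rho}$, the variables $\{\eta_t(x):x\in S\}$ are negatively correlated (i.e. $\eta_t(x)$ and $\eta_t(y)$ have non-positive covariance for $x\neq y$).
   Context: $S$ is either a finite set or $S=\mathbb Z^d$. $p(x,y)$ is an irreducible symmetric random walk transition probability on $S$: $p(x,y)=p(y,x)\ge 0$, $\sum_y p(x,y)=1$, $p(x,x)=0$. If $S=\mathbb Z^d$, $p$ is moreover translation invariant and of finite range. SEP$(n)$ is the Markov process on $\Omega=\{0,1,\dots,n\}^S$ with generator $$Lf(\eta)=\sum_{x,y\in S}\eta(x)(n-\eta(y))p(x,y)\big(f(\eta^{xy})-f(\eta)\big),$$ where $\eta^{xy}$ is obtained from $\eta$ by moving one particle from $x$ to $y$. $\mu S_t$ is the law at time $t$ when started from $\mu$. For $\overline\rho:S\to[0,1]$, $\nu_{\overline\rho}=\otimes_{x\in S}\mathrm{Bin}(n,\overline\rho(x))$ (product of binomial distributions). For $\xi\in\Omega$ with finitely many particles, $D(\xi,\eta)=\prod_xd(\xi_x,\eta_x)$ with $d(k,l)=\binom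 lk/\binom nk$ (zero if $k>l$). $\sum_{i=1}^k\delta_{x_i}$ is the configuration $\xi$ with $\xi(x)=\sum_iI(x_i=x)$. For a probability measure $\mu$ on $\Omega$, $K_\mu(x_1,\dots,x_k)=\int D(\sum_{i=1}^k\delta_{x_i},\eta)\,\mu(d\eta)$. *)

(* Defs.v *)
From HB Require Import structures.
From mathcomp Require Import all_boot all_order all_algebra.
From mathcomp Require Import all_classical all_reals all_analysis.

Set Implicit Arguments.
Unset Strict Implicit.
Unset Printing Implicit Defensive.

Import Order.TTheory GRing.Theory Num.Theory.
Import numFieldNormedType.Exports.

Local Open Scope classical_set_scope.
Local Open Scope ring_scope.

Variant site_space : Type := FiniteSites of finType | Lattice of nat.

Definition site (G : site_space) : choiceType :=
  match G with
  | FiniteSites T => T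
  | Lattice d => 'rV[int]_d
  end.

Record irreducible_symmetric (R : realType) (S : choiceType)
    (p : S -> S -> R) : Prop := IrreducibleSymmetric {
  walk_sym : forall x y, p x y = p y x;
  walk_ge0 : forall x y, 0 <= p x y;
  walk_sum1 : forall x, (\esum_(y in [set: S]) (p x y)%:E = 1)%E;
  walk_diag : forall x, p x x = 0;
  walk_irreducible : forall x y, exists s : seq S,
    path (fun a b => 0 < p a b) x s /\ last x s = y }.

Definition translation_invariant (R : realType) (d : nat)
    (p : 'rV[int]_d -> 'rV[int]_d -> R) : Prop :=
  forall z x y, p (x + z) (y + z) = p x y.

Definition finite_range (R : realType) (d : nat)
    (p : 'rV[int]_d -> 'rV[int]_d -> R) : Prop :=
  exists r : nat, forall x y, p x y != 0 ->
    forall i : 'I_d, `|y ord0 i - x ord0 i| <= r%:Z.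

Definition random_walk (R : realType) (G : site_space) :
    (site G -> site G -> R) -> Prop :=
  match G return (site G -> site G -> R) -> Prop with
  | FiniteSites _ => fun p => irreducible_symmetric p
  | Lattice _ => fun p =>
      [/\ irreducible_symmetric p, translation_invariant p & finite_range p]
  end.

Definition config (S : choiceType) (n : nat) : Type := S -> 'I_n.+1.

HB.instance Definition _ (S : choiceType) (n : nat) :=
  Choice.copy (config S n) (S -> 'I_n.+1).
HB.instance Definition _ (S : choiceType) (n : nat) :=
  isPointed.Build (config S n) (fun=> ord0).

Definition coordinate_sets (S : choiceType) (n : nat) : set (set (config S n)) :=
  [set A | exists (x : S) (k : 'I_n.+1), A = [set eta | eta x = k]].

(* {0,...,n}^S with its product sigma-algebra, which for countable S is the
   Borel sigma-algebra of the product topology. *)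
Definition Omega (S : choiceType) (n : nat) :=
  g_sigma_algebraType (@coordinate_sets S n).

(* Omega only carries a measurable structure; continuity refers to the product
   of the discrete topologies. *)
Definition ccontinuous (R : realType) (S : choiceType) (n : nat)
    (f : Omega S n -> R) : Prop :=
  continuous (f : {ptws S -> discrete_topology 'I_n.+1} -> R).

Definition cylinder (R : realType) (S : choiceType) (n : nat)
    (f : Omega S n -> R) : Prop :=
  exists s : seq S, forall eta zeta : Omega S n,
    (forall x, x \in s -> eta x = zeta x) -> f eta = f zeta.

(* Only meaningful if x != y, 0 < eta x and eta y < n; in all other cases the
   rate of the jump from x to y vanishes. *)
Definition move (S : choiceType) (n : nat) (eta : Omega S n) (x y : S) :
    Omega S n :=
  fun z => if z == x then inord (eta x).-1
           else if z == y then inord (eta y).+1 else eta z.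

(* If f is a cylinder function and p is a random walk on a finite set or a
   finite range random walk on Z^d, only finitely many terms are nonzero. *)
Definition sep_generator (R : realType) (S : choiceType) (n : nat)
    (p : S -> S -> R) (f : Omega S n -> R) (eta : Omega S n) : R :=
  \sum_(e \in [set: S * S])
    (nat_of_ord (eta e.1))%:R * (n - eta e.2)%:R * p e.1 e.2
      * (f (move eta e.1 e.2) - f eta).

Definition semigroup (R : realType) (S : choiceType) (n : nat)
    (P : R -> R.-pker Omega S n ~> Omega S n) (t : R) (f : Omega S n -> R)
    (eta : Omega S n) : R :=
  \int[P t eta]_zeta f zeta.

(* f is in the domain of the generator of the semigroup, which maps f to g. *)
Definition in_generator (R : realType) (S : choiceType) (n : nat)
    (P : R -> R.-pker Omega S n ~> Omega S n) (f g : Omega S n -> R) : Prop :=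
  {uniform, (fun t : R => fun eta => (semigroup P t f eta - f eta) / t)
              @ 0^'+ --> g}.

(* (f, g) lies in the closure, for the sup norm, of the graph of the
   pregenerator on cylinder functions. *)
Definition in_closure (R : realType) (S : choiceType) (n : nat)
    (p : S -> S -> R) (f g : Omega S n -> R) : Prop :=
  exists F : nat -> Omega S n -> R,
    [/\ forall j, cylinder (F j),
        {uniform, F @ \oo --> f} &
        {uniform, (fun j => sep_generator p (F j)) @ \oo --> g}].

(* SEP(n) as a Feller process: P t eta is the law at time t of the process
   started from eta; only times t >= 0 matter. *)
Record sep_process (R : realType) (S : choiceType) (n : nat)
    (p : S -> S -> R) (P : R -> R.-pker Omega S n ~> Omega S n) : Prop :=
  SepProcess {
  sep_start : forall eta (A : set (Omega S n)), measurable A ->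
    P 0 eta A = \d_eta A;
  sep_markov : forall s t eta (A : set (Omega S n)), 0 <= s -> 0 <= t ->
    measurable A -> P (s + t) eta A = kcomp_noparam (P s) (P t) eta A;
  sep_feller : forall t f, 0 <= t -> ccontinuous f ->
    ccontinuous (semigroup P t f);
  sep_strongly_continuous : forall f, ccontinuous f ->
    {uniform, (fun t : R => semigroup P t f) @ 0^'+ --> f};
  sep_has_generator : forall f g, ccontinuous f ->
    (in_generator P f g <-> in_closure p f g) }.

Section law_after.
Context d1 d2 (X : measurableType d1) (Y : measurableType d2) (R : realType).
Variables (mu : probability X R) (k : R.-pker X ~> Y).
Local Open Scope ereal_scope.

(* mu S_t for k := P t. *)
Definition law_after (A : set Y) : \bar R := \int[mu]_x k x A.

Let law_after0 : law_after set0 = 0.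
Proof. by apply: integral0_eq => x _; rewrite measure0. Qed.

Let law_after_ge0 A : 0 <= law_after A.
Proof. exact: integral_ge0. Qed.

Let law_after_sigma_additive : semi_sigma_additive law_after.
Proof.
move=> F mF tF mUF.
rewrite [X in _ --> X](_ : _ = \sum_(0 <= i <oo) law_after (F i)).
  by apply: is_cvg_ereal_nneg_natsum => i _; exact: law_after_ge0.
rewrite /law_after -integral_nneseries//.
- by apply: eq_integral => x _; rewrite measure_semi_bigcup.
- by move=> i; exact: measurable_kernel.
Qed.

HB.instance Definition _ := isMeasure.Build _ _ _ law_after
  law_after0 law_after_ge0 law_after_sigma_additive.

Let law_after_setT : law_after [set: Y] = 1.
Proof.
rewrite /law_after (eq_integral (cst 1)) => [|x _]; last exact: prob_kernel.
by rewrite integral_cst//= mul1e; exact: probability_setT.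
Qed.

HB.instance Definition _ :=
  Measure_isProbability.Build _ _ _ law_after law_after_setT.

End law_after.

(* nu is the product over S of the laws Bin(n, rho x): the finite-dimensional
   marginals determine a probability measure on Omega. *)
Definition product_binomial (R : realType) (S : choiceType) (n : nat)
    (rho : S -> R) (nu : probability (Omega S n) R) : Prop :=
  forall (s : seq S) (A : S -> set nat), uniq s ->
    nu [set eta | forall x, x \in s -> A x (eta x)] =
    (\prod_(x <- s) binomial_prob n (rho x) (A x))%E.

Definition dual_d (R : realType) (n k l : nat) : R := 'C(l, k)%:R / 'C(n, k)%:R.

(* dual_d R n 0 l = 1, so only the finitely many sites in the support of xi
   contribute. *)
Definition dual_D (R : realType) (S : choiceType) (n : nat)
    (xi : S -> nat) (eta : Omega S n) : R :=
  \big[*%R/1]_(x \in [set: S]) dual_d R n (xi x) (eta x).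

Definition particles (S : choiceType) (xs : seq S) (x : S) : nat :=
  (\sum_(y <- xs) (y == x))%N.

Definition K (R : realType) (S : choiceType) (n : nat)
    (mu : probability (Omega S n) R) (xs : seq S) : R :=
  \int[mu]_eta dual_D R (particles xs) eta.

(* Main.v *)
Require Import Defs.
From mathcomp Require Import all_boot all_order all_algebra.
From mathcomp Require Import all_classical all_reals all_analysis.
From mathcomp Require Import measurable_realfun.
From mathcomp Require Import ring lra zify.


(** Self-duality of SEP(n) turns [u t x], the moment K of the law at time t at
    the tuple x, into the solution of u' = A u, where A is the generator of
    SEP(n) on admissible k-tuples.  The product [v t x] of the one-point
    moments solves v' = B v, where B generates k independent walks, and
    symmetrising in i and j gives, for [v = \prod_i f (x_i)],
      (B - A) v = 1/2 \sum_(i != j) p(x_i, x_j) (f x_i - f x_j)^2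
                    \prod_(l != i, j) f (x_l) >= 0.
    Hence w = u - v satisfies w' <= A w, and w = 0 at time 0 because the factorial
    moments of Bin(n, r) are powers of r.  As A has bounded jump rates, the
    maximum principle gives w <= 0. *)

Set Implicit Arguments.
Unset Strict Implicit.
Unset Printing Implicit Defensive.

Import Order.TTheory GRing.Theory Num.Theory.
Import numFieldNormedType.Exports.
Local Open Scope classical_set_scope.
Local Open Scope ring_scope.

(** * Tuples of particles *)

(** On [Z^d] there are infinitely many tuples and a supremum over them need not be attained. The
    maximum principle therefore does not look at a maximal point: it improves an a priori upper
    bound by a fixed factor and iterates. Duality holds only for tuples with at most n particles per
    site, whereas k independent walks may exceed this. The inequality is therefore propagated by A,
    which never leaves these tuples; v, an explicit product, makes sense everywhere. The generator
    gives only a right derivative at time 0, but uniformly in the starting configuration. The Markov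
    property turns this into right difference quotients uniform in the base time, which is enough
    for a two-sided derivative. Duality fails for a single directed jump and holds for the two
    directions between a pair of sites added together. Symmetry of p is what allows this pairing,
    besides its use in the symmetrisation of B - A. *)

Section jumps.
Context (S : choiceType) (k : nat).
Implicit Types (x : 'I_k -> S) (z : S).

Definition jump x (i : 'I_k) (y : S) : 'I_k -> S :=
  fun j => if j == i then y else x j.

Definition occ x z : nat := (\sum_(i < k) (x i == z))%N.

(** Passage between sums over sites and sums over particles. The list [s] need only contain the
    particles at which [F] does not vanish, so a list of neighbours qualifies. *)
Lemma sum_occ (R : pzRingType) x (s : seq S) (F : S -> R) : uniq s ->
    (forall i, F (x i) != 0 -> x i \in s) ->
  \sum_(y <- s) (occ x y)%:R * F y = \sum_(i < k) F (x i).
Proof.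
move=> us sF.
under eq_bigr do rewrite natr_sum mulr_suml.
rewrite exchange_big/=; apply: eq_bigr => i _.
have [xis|xis] := boolP (x i \in s).
  rewrite (bigD1_seq (x i))//= eqxx mul1r big1 ?addr0// => y yi.
  by rewrite eq_sym (negPf yi) mul0r.
rewrite big1_seq => [|y /= ys]; last first.
  by have [xy|_] /= := eqVneq (x i) y; [rewrite xy ys in xis|rewrite mul0r].
by have [//|/sF] := eqVneq (F (x i)) 0; rewrite (negPf xis).
Qed.

(** Additions on both sides avoid truncated subtraction and cover the case [y = x i]. *)
Lemma occ_jump x i y z : (occ (jump x i y) z + (x i == z) = occ x z + (y == z))%N.
Proof.
rewrite /occ (bigD1 i)//= [in RHS](bigD1 i)//= /jump eqxx.
under eq_bigr => j ji do rewrite (negPf ji).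
by rewrite addnC addnCA addnC.
Qed.

End jumps.

Lemma is_derive_prod (R : numFieldType) (I : eqType) (s : seq I)
    (h : I -> R -> R) (dh : I -> R) (t : R) :
  uniq s -> (forall i, is_derive t 1 (h i) (dh i)) ->
  is_derive t 1 (fun r => \prod_(i <- s) h i r)
    (\sum_(i <- s) dh i * \prod_(j <- s | j != i) h j t).
Proof.
move=> + hdh; elim: s => [_|a s IH /= /andP[as_ us]].
  rewrite big_nil; apply: (@is_derive_eq _ _ _ _ _ _ 0 _ _) => //.
  by under eq_fun do rewrite big_nil; exact: is_derive_cst.
have -> : (fun r => \prod_(i <- a :: s) h i r) =
    h a * (fun r => \prod_(i <- s) h i r).
  by apply/funext => r; rewrite big_cons.
have := IH us => ?.
apply: is_derive_eq.
rewrite big_cons/= big_cons eqxx/= addrC; congr (_ + _).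
  rewrite mulrC; congr (_ * _); rewrite big_seq_cond [RHS]big_seq_cond.
  apply: eq_bigl => j; have [->|] := eqVneq j a; rewrite ?(negPf as_) ?andbT ?andbF //.
rewrite /GRing.scale/= mulr_sumr; rewrite [LHS]big_seq [RHS]big_seq.
apply: eq_bigr => i si.
rewrite big_cons ifT; first by rewrite mulrCA.
by apply: contra as_ => /eqP ->.
Qed.

(** * Maximum principle *)

(* [nb x] may list more sites than those charged by [p x]. *)
Record local_walk (R : realType) (S : choiceType) (p : S -> S -> R)
    (nb : S -> seq S) : Prop := LocalWalk {
  lw_sym : forall x y, p x y = p y x;
  lw_ge0 : forall x y, 0 <= p x y;
  lw_diag : forall x, p x x = 0;
  lw_uniq : forall x, uniq (nb x);
  lw_nb : forall x y, p x y != 0 -> y \in nb x;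
  lw_sum : forall x, \sum_(y <- nb x) p x y = 1 }.

Section comparison.
Context (R : realType) (S : choiceType) (n k : nat) (p : S -> S -> R)
  (nb : S -> seq S).
Hypothesis hp : local_walk p nb.
Implicit Types (x : 'I_k -> S) (F : ('I_k -> S) -> R) (f : S -> R).

Definition admissible x := forall z, (occ x z <= n)%N.

(* The rate [n - occ x y] is a truncated difference, exact on admissible tuples. *)
Definition sep_dual F x : R :=
  \sum_(i < k) \sum_(y <- nb (x i))
    (n - occ x y)%:R * p (x i) y * (F (jump x i y) - F x).

(** The factor [n] is the jump rate of a lone particle, so this is [sep_dual] for [k = 1]. *)
Definition walk_generator f (a : S) : R :=
  n%:R * \sum_(y <- nb a) p a y * (f y - f a).

Lemma admissible_jump x i y : admissible x -> (occ x y < n)%N ->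
  admissible (jump x i y).
Proof.
move=> adx xyn z; have := occ_jump x i y z; have := adx z.
have [<-|_] := eqVneq y z; case: (x i == _) => /=; rewrite ?addn0 ?addn1; lia.
Qed.

Lemma sep_dual_rate x :
  \sum_(i < k) \sum_(y <- nb (x i)) (n - occ x y)%:R * p (x i) y
    <= (k * n)%:R.
Proof.
apply: (@le_trans _ _ (\sum_(i < k) n%:R)); last first.
  by rewrite sumr_const card_ord natrM mulr_natl.
apply: ler_sum => i _; rewrite -[leRHS]mulr1 -[X in _ <= _ * X](lw_sum hp (x i)) mulr_sumr.
apply: ler_sum => y _; apply: ler_wpM2r; first exact: (lw_ge0 hp).
by rewrite ler_nat leq_subr.
Qed.

Lemma normr_sep_dual F x (C : R) : (forall y, `|F y| <= C) ->
  `|sep_dual F x| <= (k * n)%:R * (C *+ 2).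
Proof.
move=> FC; have C0 : 0 <= C by apply: le_trans (FC x).
apply: le_trans; last by apply: ler_wpM2r (sep_dual_rate x); rewrite mulrn_wge0.
rewrite mulr_suml (le_trans (ler_norm_sum _ _ _))//; apply: ler_sum => i _.
rewrite mulr_suml (le_trans (ler_norm_sum _ _ _))//; apply: ler_sum => y _.
have r0 : 0 <= (n - occ x y)%:R * p (x i) y by rewrite mulr_ge0// (lw_ge0 hp).
rewrite normrM (ger0_norm r0) ler_wpM2l// mulr2n.
by rewrite (le_trans (ler_normB _ _))// lerD.
Qed.

(** A jump onto a full site has rate 0, hence a bound on [F] at admissible tuples suffices. No
    maximal point is required: the gap [M - F x] takes its place. *)
Lemma sep_dual_ub F x (M : R) : admissible x ->
  (forall y, admissible y -> F y <= M) -> sep_dual F x <= (k * n)%:R * (M - F x).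
Proof.
move=> adx FM; apply: le_trans; last first.
  by apply: ler_wpM2r (sep_dual_rate x); rewrite subr_ge0 FM.
rewrite mulr_suml; apply: ler_sum => i _; rewrite mulr_suml.
apply: ler_sum => y _.
have [xyn|nxy] := ltnP (occ x y) n; last first.
  by move: nxy; rewrite -subn_eq0 => /eqP ->; rewrite !mul0r.
apply: ler_wpM2l; first by rewrite mulr_ge0// (lw_ge0 hp).
by rewrite lerB// FM//; exact: admissible_jump.
Qed.

Lemma sep_dual_prod f x : admissible x -> (forall a, 0 <= f a) ->
  sep_dual (fun y => \prod_(i < k) f (y i)) x <=
  \sum_(i < k) walk_generator f (x i) * \prod_(j < k | j != i) f (x j).
Proof.
move=> adx f0.
pose C i : R := \prod_(j < k | j != i) f (x j).
pose T i j : R := p (x i) (x j) * (f (x j) - f (x i)) * C i.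
rewrite -subr_ge0.
have -> : \sum_(i < k) walk_generator f (x i) * C i -
    sep_dual (fun y => \prod_(i < k) f (y i)) x = \sum_(i < k) \sum_(j < k) T i j.
  rewrite -sumrB; apply: eq_bigr => i _.
  (* Each rate falls short of [n] by [occ x y]; [sum_occ], read backwards, turns the sum over
     particles [j] into a sum over sites weighted by this deficit. *)
  rewrite -mulr_suml -(@sum_occ _ _ _ _ (nb (x i)) (fun y => p (x i) y * (f y - f (x i))));
    [|exact: (lw_uniq hp)|]; last first.
    by move=> j; apply: contra_neqT => /(contraNeq (@lw_nb _ _ _ _ hp _ _)) ->; rewrite mul0r.
  rewrite /walk_generator mulr_sumr !mulr_suml -sumrB; apply: eq_bigr => y _.
  have -> : \prod_(l < k) f (jump x i y l) = f y * C i.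
    rewrite (bigD1 i)//= /jump eqxx; congr (_ * _).
    by apply: eq_bigr => j /negPf ->.
  have -> : \prod_(l < k) f (x l) = f (x i) * C i by rewrite (bigD1 i).
  rewrite natrB//; ring.
(* T i j + T j i = p(x_i, x_j) (f x_j - f x_i)^2 \prod_(l != i, j) f (x_l) *)
have T0 i j : 0 <= T i j + T j i.
  have [->|ij] := eqVneq i j; first by rewrite /T (lw_diag hp) !mul0r addr0.
  pose D : R := \prod_(l < k | (l != i) && (l != j)) f (x l).
  have Ci : C i = f (x j) * D by rewrite /C (bigD1 j)//= eq_sym.
  have Cj : C j = f (x i) * D.
    by rewrite /C (bigD1 i)//=; congr (_ * _); apply: eq_bigl => l; rewrite andbC.
  have -> : T i j + T j i = p (x i) (x j) * ((f (x j) - f (x i)) ^+ 2 * D).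
    rewrite /T Ci Cj (lw_sym hp (x j)); ring.
  by rewrite mulr_ge0 ?(lw_ge0 hp)// mulr_ge0 ?sqr_ge0// prodr_ge0.
have : 0 <= \sum_(i < k) \sum_(j < k) (T i j + T j i).
  by apply: sumr_ge0 => i _; apply: sumr_ge0.
under eq_bigr do rewrite big_split/=.
by rewrite big_split/= [X in _ + X]exchange_big/= -mulr2n pmulrn_lge0.
Qed.

(* The jump rates of [sep_dual] add up to at most c = k n, so that
   [expR (c t) * (W t x - M)] is nonincreasing in t. *)
Lemma max_principle_step (W dW : R -> ('I_k -> S) -> R) (T M : R) : 0 <= M ->
    (forall x, admissible x -> {within `[0, T], continuous (W ^~ x)}) ->
    (forall x t, admissible x -> 0 < t < T -> is_derive t 1 (W ^~ x) (dW t x)) ->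
    (forall x t, admissible x -> 0 < t < T -> dW t x <= sep_dual (W t) x) ->
    (forall x, admissible x -> W 0 x <= 0) ->
    (forall x t, admissible x -> 0 <= t <= T -> W t x <= M) ->
  forall x t, admissible x -> 0 <= t <= T ->
    W t x <= M * (1 - expR (- ((k * n)%:R * T))).
Proof.
move=> M0 Wc Wd dWle W0 WM x t adx /andP[t0 tT].
pose c : R := (k * n)%:R.
have c0 : 0 <= c by [].
pose g : R -> R := (fun r => expR (c * r)) * (fun r => W r x - M).
have gd r : 0 < r < T -> is_derive r 1 g (expR (c * r) * (dW r x + c * (W r x - M))).
  move=> rT; have ? := Wd x r adx rT.
  apply: is_derive_eq; rewrite /GRing.scale/=; ring.
have gc : {within `[0, T], continuous g}.
  move=> r; apply: cvgM; last by apply: cvgB; [exact: Wc|exact: cvg_cst].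
  apply: continuous_subspaceT => s.
  apply: (@continuous_comp _ _ _ (fun r : R => c * r) expR).
    exact: mulrl_continuous.
  exact: continuous_expR.
have : g t <= g 0.
  apply: (@ler0_derive1_le_cc _ g 0 T) => //.
  - by move=> r; rewrite in_itv/= => /gd [].
  - move=> r; rewrite in_itv/= => rT; have [_] := gd r rT.
    rewrite derive1E => ->; rewrite pmulr_rle0 ?expR_gt0//.
    have := sep_dual_ub adx (fun y ady => WM y r ady _).
    have rT' : 0 <= r <= T by case/andP: rT => ? ?; rewrite !ltW.
    move=> /(_ rT'); rewrite -/c; have := dWle x r adx rT; lra.
  - by rewrite in_itv/= t0.
  - by rewrite in_itv/= lexx (le_trans t0).
rewrite /g !fctE mulr0 expR0 mul1r => gt.
have {gt} : expR (c * t) * (W t x - M) <= - M.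
  by apply: le_trans gt _; have := W0 x adx; lra.
rewrite -ler_pdivlMl ?expR_gt0// -expRN => h.
(* Passing from [t] to [T] makes the new bound uniform in time, so that it can serve as the next
   [M]. *)
have : expR (- (c * T)) * M <= expR (- (c * t)) * M.
  by apply: ler_wpM2r => //; rewrite ler_expR lerN2 ler_wpM2l.
rewrite -/c; lra.
Qed.

(** Each application of [max_principle_step] multiplies the upper bound by the same [q < 1], and
    [M * q ^+ j] tends to 0. *)
Lemma max_principle (W dW : R -> ('I_k -> S) -> R) (T M : R) : 0 <= M ->
    (forall x, admissible x -> {within `[0, T], continuous (W ^~ x)}) ->
    (forall x t, admissible x -> 0 < t < T -> is_derive t 1 (W ^~ x) (dW t x)) ->
    (forall x t, admissible x -> 0 < t < T -> dW t x <= sep_dual (W t) x) ->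
    (forall x, admissible x -> W 0 x <= 0) ->
    (forall x t, admissible x -> 0 <= t <= T -> W t x <= M) ->
  forall x t, admissible x -> 0 <= t <= T -> W t x <= 0.
Proof.
move=> M0 Wc Wd dWle W0 WM x t adx tT.
pose q : R := 1 - expR (- ((k * n)%:R * T)).
have T0 : 0 <= T by case/andP: tT => /le_trans; apply.
have q0 : 0 <= q.
  by rewrite subr_ge0 -expR0 ler_expR oppr_le0 mulr_ge0.
have q1 : `|q| < 1.
  by rewrite ger0_norm// gtrBl expR_gt0.
have Wq j : forall y s, admissible y -> 0 <= s <= T -> W s y <= M * q ^+ j.
  elim: j => [|j IH] y s ady sT; first by rewrite expr0 mulr1 WM.
  rewrite exprSr mulrA.
  by apply: (max_principle_step (dW := dW)) => //; rewrite mulr_ge0// exprn_ge0.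
have Mq : (fun j => M * q ^+ j) @ \oo --> (0 : R).
  by rewrite -[X in _ --> X](mulr0 M); apply: cvgM; [exact: cvg_cst|exact: cvg_expr].
rewrite -(cvg_lim _ Mq)//; apply: limr_ge; first by apply/cvg_ex; exists 0.
by near=> j; exact: Wq.
Unshelve. all: by end_near. Qed.

(** The process enters only through the two evolution equations, the initial values and the bounds
    on [u] and [f]. The equation for [u] is asked only at admissible tuples, where duality will
    provide it. *)
Lemma correlation_comparison (u : R -> ('I_k -> S) -> R) (f : R -> S -> R) :
    (forall (t : R) x, 0 <= t -> u t x <= 1) ->
    (forall (t : R) a, 0 <= t -> 0 <= f t a) ->
    (forall x (T : R), admissible x -> {within `[0, T], continuous (u ^~ x)}) ->
    (forall a (T : R), {within `[0, T], continuous (f ^~ a)}) ->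
    (forall x (t : R), admissible x -> 0 < t ->
      is_derive t 1 (u ^~ x) (sep_dual (u t) x)) ->
    (forall a (t : R), 0 < t -> is_derive t 1 (f ^~ a) (walk_generator (f t) a)) ->
    (forall x, admissible x -> u 0 x = \prod_(i < k) f 0 (x i)) ->
  forall (t : R) x, 0 <= t -> admissible x -> u t x <= \prod_(i < k) f t (x i).
Proof.
move=> u1 f0 uc fc ud fd u0 t x t0 adx.
pose v (r : R) (y : 'I_k -> S) := \prod_(i < k) f r (y i).
pose dv (r : R) y := \sum_(i < k) walk_generator (f r) (y i) *
  \prod_(j < k | j != i) f r (y j).
rewrite -subr_le0.
(* The a priori bound [M = 1] comes from [u <= 1] and [0 <= v]. *)
apply: (@max_principle (fun r y => u r y - v r y)
  (fun r y => sep_dual (u r) y - dv r y) t 1) => //; last by rewrite t0 lexx.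
- move=> y ady r; apply: cvgB; first exact: uc.
  exact: (@cvg_big R^o _ *%R 1 predT (@mul_continuous R) (subspace `[0, t])
    (nbhs r) (index_enum 'I_k) (fun i (s : R) => f s (y i))
    (fun i => f r (y i)) _ (fun i _ => fc (y i) t r)).
- move=> y r ady /andP[r0 _]; apply: is_deriveB; first exact: ud.
  by apply: is_derive_prod; [exact: index_enum_uniq|move=> i; exact: fd].
- move=> y r ady /andP[r0 _].
  have := @sep_dual_prod (f r) y ady (fun a => f0 r a (ltW r0)).
  rewrite -/(dv r y) => h.
  apply: le_trans (lerB (lexx _) h) _.
  rewrite /sep_dual -sumrB; apply: ler_sum => i _.
  rewrite -sumrB; apply: ler_sum => z _.
  rewrite -mulrBr le_eqVlt; apply/orP; left; apply/eqP; rewrite /v; ring.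
- by move=> y ady; rewrite /v u0// subrr.
- move=> y r ady /andP[r0 _]; rewrite lerBlDr.
  by rewrite (le_trans (u1 _ _ r0))// lerDl prodr_ge0// => i _; exact: f0.
Qed.

End comparison.

(** * Self-duality *)

Lemma sum_seq_sub (R : nmodType) (S : eqType) (r s : seq S) (F : S -> R) :
    uniq r -> uniq s -> {subset r <= s} ->
    (forall y, y \in s -> y \notin r -> F y = 0) ->
  \sum_(y <- s) F y = \sum_(y <- r) F y.
Proof.
move=> ur us rs F0.
rewrite (bigID (mem r))/= [X in _ + X]big1_seq ?addr0; last first.
  by move=> y /andP[yr ys]; exact: F0.
rewrite -big_filter; apply: perm_big; apply: uniq_perm => //.
  exact: filter_uniq.
by move=> y; rewrite mem_filter; case: (boolP (y \in r)) => [/rs|].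
Qed.

Section dual_d.
Context (R : realType) (n : nat).
Local Notation d := (dual_d R n).

Lemma dual_d0 l : d 0 l = 1.
Proof. by rewrite /dual_d !bin0 divr1. Qed.

Lemma dual_d1 l : d 1 l = l%:R / n%:R.
Proof. by rewrite /dual_d !bin1. Qed.

Lemma dual_d_ge0 j l : 0 <= d j l.
Proof. by rewrite /dual_d divr_ge0. Qed.

Lemma dual_d_le1 j l : (l <= n)%N -> d j l <= 1.
Proof.
move=> ln; have [jn|nj] := leqP j n; last first.
  by rewrite /dual_d [X in X / _](_ : _ = 0) ?mul0r// bin_small// (leq_ltn_trans ln).
by rewrite ler_pdivrMr ?ltr0n ?bin_gt0// mul1r ler_nat leq_bin2l.
Qed.

Lemma bin_neq0 j : (j <= n)%N -> 'C(n, j)%:R != 0 :> R.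
Proof. by move=> jn; rewrite pnatr_eq0 -lt0n bin_gt0. Qed.

(* [e j l] is the increment of [d j] from l to l + 1. *)
Let e (j l : nat) : R := if j is j'.+1 then 'C(l, j')%:R / 'C(n, j)%:R else 0.

Let dualS j l : d j l.+1 = d j l + e j l.
Proof.
case: j => [|j]; first by rewrite !dual_d0 addr0.
by rewrite /dual_d /e binS natrD mulrDl.
Qed.

Let dualP j l : l%:R * d j l.-1 = (l%:R - j%:R) * d j l.
Proof.
rewrite /dual_d !mulrA -natrM mul_bin_down.
have [jl|lj] := leqP j l; first by rewrite natrM natrB.
by rewrite bin_small// muln0 mulr0.
Qed.

(** The relation between [d j l] and [e j l] that remains once all shifted values have been
    expressed through these two. *)
Let e_left j l : (l%:R - j%:R + 1) * e j l = j%:R * d j l.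
Proof.
case: j => [|j]; first by rewrite mulr0 mul0r.
rewrite /e /dual_d !mulrA -natrM mul_bin_left.
have [jl|lj] := leqP j l; first by rewrite natrM natrB// -natr1; congr (_ * _ / _); ring.
by rewrite bin_small// muln0 mulr0.
Qed.

Let dual_down j l : (j <= n)%N -> j%:R * d j.-1 l = (n%:R - j%:R + 1) * e j l.
Proof.
case: j => [|j] jn; first by rewrite mulr0 mul0r.
have h : j.+1%:R * 'C(n, j.+1)%:R = (n%:R - j%:R) * 'C(n, j)%:R :> R.
  by rewrite -natrM mul_bin_left natrM natrB// ltnW.
have b1 := bin_neq0 jn; have b0 := bin_neq0 (ltnW jn).
rewrite /e /dual_d/=.
have -> : n%:R - j.+1%:R + 1 = n%:R - j%:R :> R by rewrite -natr1; ring.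
apply: (mulIf b0); apply: (mulIf b1).
transitivity (j.+1%:R * 'C(n, j.+1)%:R * 'C(l, j)%:R : R); first by field.
by rewrite h; field.
Qed.

Let dual_up j l : (j <= n)%N -> (l <= n)%N ->
  (n%:R - j%:R) * d j.+1 l = (l%:R - j%:R) * d j l.
Proof.
(* At [j = n] the left side has the factor 0; the right side vanishes too, since ['C(l, n) = 0]
   unless [l = n]. *)
move=> jn ln; have [->|j_neq_n] := eqVneq j n.
  rewrite subrr mul0r; have [->|l_neq_n] := eqVneq l n; first by rewrite subrr mul0r.
  by rewrite /dual_d bin_small ?mul0r ?mulr0// ltn_neqAle l_neq_n.
have {j_neq_n} jn1 : (j < n)%N by rewrite ltn_neqAle j_neq_n.
have h : j.+1%:R * 'C(n, j.+1)%:R = (n%:R - j%:R) * 'C(n, j)%:R :> R.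
  by rewrite -natrM mul_bin_left natrM natrB// ltnW.
have h' : j.+1%:R * 'C(l, j.+1)%:R = (l%:R - j%:R) * 'C(l, j)%:R :> R.
  rewrite -natrM mul_bin_left; have [jl|lj] := leqP j l; first by rewrite natrM natrB.
  by rewrite bin_small// muln0 mulr0.
have b1 := bin_neq0 jn1; have b0 := bin_neq0 jn.
have j0 : j.+1%:R != 0 :> R by rewrite pnatr_eq0.
apply: (mulIf b0); apply: (mulIf b1); rewrite /dual_d.
transitivity ((n%:R - j%:R) * 'C(n, j)%:R * 'C(l, j.+1)%:R : R); first by field.
transitivity ((l%:R - j%:R) * 'C(l, j)%:R * 'C(n, j.+1)%:R : R); last by field.
by rewrite -h -h'; ring.
Qed.

(** Duality on two sites. After the recurrences are substituted, the difference of the two sides is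
    a combination of two instances of [e_left]. A predecessor of 0 always comes with a factor 0. *)
Lemma dual_d_duality (j l a b : nat) :
    (j <= n)%N -> (l <= n)%N -> (a <= n)%N -> (b <= n)%N ->
  a%:R * (n - b)%:R * (d j a.-1 * d l b.+1 - d j a * d l b) +
  b%:R * (n - a)%:R * (d l b.-1 * d j a.+1 - d l b * d j a) =
  j%:R * (n - l)%:R * (d j.-1 a * d l.+1 b - d j a * d l b) +
  l%:R * (n - j)%:R * (d l.-1 b * d j.+1 a - d l b * d j a).
Proof.
move=> jn ln an bn; rewrite !natrB//.
(* Regroups each product so that a shifted value stands next to the coefficient demanded by its
   recurrence. *)
have split4 (x y z t u v : R) : x * y * (z * t - u * v) =
  (x * z) * (y * t) - x * y * (u * v) by ring.
rewrite !split4 !dualP !dualS !dual_down// !dual_up//.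
have := e_left j a; have := e_left l b.
move: (d j a) (d l b) (e j a) (e l b) => X Y E F hF hE.
apply/eqP; rewrite -subr_eq0; apply/eqP.
transitivity (Y * (b%:R - l%:R) * (j%:R * X - (a%:R - j%:R + 1) * E) +
  X * (a%:R - j%:R) * (l%:R * Y - (b%:R - l%:R + 1) * F)); first by ring.
by rewrite hE hF !subrr !mulr0 addr0.
Qed.

End dual_d.

Section duality.
Context (R : realType) (S : choiceType) (n : nat).
Implicit Types (xi : S -> nat) (eta : Omega S n).

Lemma dual_D_seq xi eta (s : seq S) : uniq s ->
    (forall z, xi z != 0 -> z \in s)%N ->
  dual_D R xi eta = \prod_(z <- s) dual_d R n (xi z) (eta z).
Proof.
move=> us xis; rewrite /dual_D (@fsbigE _ _ _ _ _ s)//.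
  by apply: eq_bigl => z; rewrite in_setT.
by move=> z _; apply: contraNeq => d1; apply: xis; apply: contra_neq d1 => ->; rewrite dual_d0.
Qed.

(** Analogue of [move] for dual particles, in occupation numbers; meant for [a != b] and
    [0 < xi a]. *)
Definition hop xi (a b : S) : S -> nat :=
  fun z => if z == a then (xi a).-1 else if z == b then (xi b).+1 else xi z.

Lemma dual_D_pair xi eta (s : seq S) (a b : S) : uniq s ->
    (forall z, xi z != 0 -> z \in s)%N -> a \in s -> b \in s -> a != b ->
  dual_D R xi eta = dual_d R n (xi a) (eta a) * dual_d R n (xi b) (eta b) *
    \prod_(z <- s | (z != a) && (z != b)) dual_d R n (xi z) (eta z).
Proof.
move=> us xis sa sb ab; rewrite (dual_D_seq _ us)// (bigD1_seq a)//=.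
rewrite -mulrA; congr (_ * _); rewrite -big_filter (bigD1_seq b)/=.
- by rewrite big_filter_cond.
- by rewrite mem_filter eq_sym ab.
- exact: filter_uniq.
Qed.

(** Only the coordinates [a] and [b] change, so this is [dual_d_duality] times the product over the
    other sites. *)
Lemma generator_duality_pair xi eta (s : seq S) (a b : S) : uniq s ->
    (forall z, xi z <= n)%N -> (forall z, xi z != 0 -> z \in s)%N ->
    a \in s -> b \in s -> a != b ->
  (eta a)%:R * (n - eta b)%:R *
    (dual_D R xi (move eta a b) - dual_D R xi eta) +
  (eta b)%:R * (n - eta a)%:R *
    (dual_D R xi (move eta b a) - dual_D R xi eta) =
  (xi a)%:R * (n - xi b)%:R *
    (dual_D R (hop xi a b) eta - dual_D R xi eta) +
  (xi b)%:R * (n - xi a)%:R *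
    (dual_D R (hop xi b a) eta - dual_D R xi eta).
Proof.
move=> us xin xis sa sb ab.
have eta_le z : (eta z <= n)%N by rewrite -ltnS ltn_ord.
pose Q := \prod_(z <- s | (z != a) && (z != b)) dual_d R n (xi z) (eta z).
have -> : dual_D R xi eta =
    dual_d R n (xi a) (eta a) * dual_d R n (xi b) (eta b) * Q.
  exact: dual_D_pair.
(* The factor [n - eta e] is kept on both sides because on a full site [e] the [inord] in [move] is
   out of range. *)
have moveE c e : c \in s -> e \in s -> c != e ->
    \prod_(z <- s | (z != c) && (z != e)) dual_d R n (xi z) (eta z) = Q ->
    (n - eta e)%:R * dual_D R xi (move eta c e) =
    (n - eta e)%:R * (dual_d R n (xi c) (eta c).-1 * dual_d R n (xi e) (eta e).+1 * Q).
  move=> sc se ce Qce; have [ne|en] := leqP n (eta e).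
    by have -> : (n - eta e = 0)%N; [apply/eqP; rewrite subn_eq0|rewrite !mul0r].
  congr (_ * _); rewrite (dual_D_pair _ us xis sc se ce) /move eqxx.
  rewrite [e == c]eq_sym (negPf ce) eqxx !inordK ?ltnS//; last first.
    by rewrite (leq_trans (leq_pred _)).
  congr (_ * _); rewrite -Qce; apply: eq_bigr => z /andP[zc ze].
  by rewrite (negPf zc) (negPf ze).
have hopE c e : c \in s -> e \in s -> c != e ->
    \prod_(z <- s | (z != c) && (z != e)) dual_d R n (xi z) (eta z) = Q ->
    dual_D R (hop xi c e) eta =
    dual_d R n (xi c).-1 (eta c) * dual_d R n (xi e).+1 (eta e) * Q.
  move=> sc se ce Qce.
  rewrite (dual_D_pair _ us _ sc se ce) /hop; last first.
    by move=> z; have [->//|_] := eqVneq z c; have [->//|_] := eqVneq z e; exact: xis.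
  rewrite eqxx [e == c]eq_sym (negPf ce) eqxx; congr (_ * _); rewrite -Qce.
  by apply: eq_bigr => z /andP[zc ze]; rewrite (negPf zc) (negPf ze).
have Qba : \prod_(z <- s | (z != b) && (z != a)) dual_d R n (xi z) (eta z) = Q.
  by apply: eq_bigl => z; rewrite andbC.
rewrite !hopE// 1?eq_sym//.
have := moveE _ _ sa sb ab erefl.
have ba : b != a by rewrite eq_sym.
have := moveE _ _ sb sa ba Qba.
have := dual_d_duality R (xin a) (xin b) (eta_le a) (eta_le b).
move: (dual_d R n) (dual_D R xi (move eta a b)) (dual_D R xi (move eta b a)).
move=> dd A B h hB hA.
transitivity ((eta a)%:R * ((n - eta b)%:R * A) + (eta b)%:R * ((n - eta a)%:R * B) -
  ((eta a)%:R * (n - eta b)%:R + (eta b)%:R * (n - eta a)%:R) *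
    (dd (xi a) (eta a) * dd (xi b) (eta b) * Q)); first by ring.
rewrite hA hB.
move/(congr1 (fun r => r * Q)): h => h.
by apply: etrans (etrans h _); ring.
Qed.

Context (k : nat) (p : S -> S -> R) (nb : S -> seq S).
Hypothesis hp : local_walk p nb.

Lemma occ_neq0 (x : 'I_k -> S) z : (occ x z != 0)%N -> exists i, x i = z.
Proof.
by rewrite /occ sum_nat_eq0 => /forallPn[i]; rewrite eqb0 negbK => /eqP; exists i.
Qed.

Definition tupleD (x : 'I_k -> S) eta : R := dual_D R (occ x) eta.

Lemma sep_generator_duality (x : 'I_k -> S) eta : admissible n x ->
  sep_generator p (tupleD x) eta = sep_dual n p nb (tupleD ^~ eta) x.
Proof.
move=> adx.
(* Occupied sites and their possible targets: outside this finite list neither generator has a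
   nonzero term. *)
pose s := undup (codom x ++ flatten [seq nb a | a <- codom x]).
have us : uniq s by exact: undup_uniq.
have xs i : x i \in s by rewrite mem_undup mem_cat codom_f.
have nbs i : {subset nb (x i) <= s}.
  move=> y yi; rewrite mem_undup mem_cat; apply/orP; right.
  by apply/flattenP; exists (nb (x i)) => //; apply: map_f; exact: codom_f.
have occs z : (occ x z != 0)%N -> z \in s by move=> /occ_neq0[i <-].
have in_s a b : p a b != 0 -> (occ x a != 0)%N -> (a \in s) && (b \in s).
  move=> + /occ_neq0[i xi]; rewrite -{}xi => pab.
  by rewrite xs; apply: (nbs i); exact: (lw_nb hp).
have inner i : \sum_(b <- s) (n - occ x b)%:R * p (x i) b *
      (tupleD (jump x i b) eta - tupleD x eta) =
    \sum_(b <- nb (x i)) (n - occ x b)%:R * p (x i) b *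
      (tupleD (jump x i b) eta - tupleD x eta).
  apply: (sum_seq_sub (lw_uniq hp (x i)) us (@nbs i)) => y _.
  by move=> /(contraNeq (@lw_nb _ _ _ _ hp _ _)) ->; rewrite mulr0 mul0r.
pose F a b := (eta a)%:R * (n - eta b)%:R * p a b *
  (tupleD x (move eta a b) - tupleD x eta).
pose G a b := (occ x a)%:R * ((n - occ x b)%:R * p a b *
  (dual_D R (hop (occ x) a b) eta - tupleD x eta)).
transitivity (\sum_(a <- s) \sum_(b <- s) F a b).
  rewrite /sep_generator (@fsbigE _ _ _ _ _ (allpairs pair s s))//.
  - rewrite big_mkcond/= big_allpairs/=; apply: eq_bigr => a _.
    by apply: eq_bigr => b _; rewrite in_setT.
  - by apply: allpairs_uniq => // -[? ?] [? ?].
  move=> [a b] _ /= abs.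
  (* If [p a b != 0] and the pair is not listed, neither site carries a dual particle, so moving a
     particle of [eta] between them does not change [tupleD x]. *)
  have [->|pab] := eqVneq (p a b) 0; first by rewrite mulr0 mul0r.
  have nab : ~~ ((a \in s) && (b \in s)).
    by apply: contra abs => /andP[]; exact: allpairs_f.
  have occa : occ x a = 0%N by apply/eqP; apply: contraNT nab; exact: in_s.
  have occb : occ x b = 0%N.
    by apply/eqP; apply: contraNT nab; rewrite andbC; apply: in_s; rewrite (lw_sym hp).
  rewrite [X in _ * X](_ : _ = 0) ?mulr0//; apply/eqP; rewrite subr_eq0; apply/eqP.
  apply: eq_fsbigr => z _; rewrite /move.
  by have [->|_] := eqVneq z a; [rewrite occa !dual_d0|
     have [->|//] := eqVneq z b; rewrite occb !dual_d0].
transitivity (\sum_(a <- s) \sum_(b <- s) G a b).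
  (* Equality holds only for the two directions together, so both double sums are doubled,
     symmetrised and compared pair by pair. *)
  have FG a b : a \in s -> b \in s -> F a b + F b a = G a b + G b a.
    move=> sa sb; have [->|ab] := eqVneq a b.
      by rewrite /F /G (lw_diag hp) !(mulr0, mul0r).
    have := generator_duality_pair eta us adx occs sa sb ab.
    rewrite /F /G /tupleD (lw_sym hp b a) => h.
    transitivity (p a b * ((eta a)%:R * (n - eta b)%:R *
      (dual_D R (occ x) (move eta a b) - dual_D R (occ x) eta) +
      (eta b)%:R * (n - eta a)%:R *
      (dual_D R (occ x) (move eta b a) - dual_D R (occ x) eta))); first by ring.
    by rewrite h; ring.
  have twice (H : S -> S -> R) : (\sum_(a <- s) \sum_(b <- s) H a b) *+ 2 =
      \sum_(a <- s) \sum_(b <- s) (H a b + H b a).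
    rewrite mulr2n [X in _ + X]exchange_big -big_split; apply: eq_bigr => a _.
    by rewrite big_split.
  apply: (@pmulrnI R 2) => //=; rewrite !twice.
  rewrite [LHS]big_seq [RHS]big_seq; apply: eq_bigr => a sa.
  by rewrite [LHS]big_seq [RHS]big_seq; apply: eq_bigr => b sb; exact: FG.
under eq_bigr do rewrite -mulr_sumr.
rewrite (sum_occ us) => [|i _]; last exact: xs.
apply: eq_bigr => i _; rewrite -inner; apply: eq_bigr => y _.
(* At [y = x i] the function [hop] would lose a particle while [jump] does nothing; the rate is 0
   there. *)
have [<-|xy] := eqVneq (x i) y; first by rewrite (lw_diag hp) !(mulr0, mul0r).
suff hopE : hop (occ x) (x i) y = occ (jump x i y) by rewrite /tupleD hopE.
apply/funext => z; rewrite /hop; have := occ_jump x i y z.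
have [->|zx] := eqVneq z (x i).
  by rewrite [y == x i]eq_sym (negPf xy) addn0 addn1 => <-.
have [->|zy] := eqVneq z y; first by rewrite addn0 addn1 => ->.
by rewrite !addn0.
Qed.

End duality.

(** * Binomial moments *)

(** Both sides count the m-subsets of j-subsets of an n-set. *)
Lemma mul_bin_bin (n j m : nat) : (m <= j <= n)%N ->
  ('C(n, j) * 'C(j, m) = 'C(n, m) * 'C(n - m, j - m))%N.
Proof.
case/andP => mj jn; have mn := leq_trans mj jn.
have f0 : (0 < m`! * (j - m)`! * (n - j)`!)%N by rewrite !muln_gt0 !fact_gt0.
apply/eqP; rewrite -(eqn_pmul2r f0); apply/eqP.
transitivity n`!.
  by rewrite -(bin_fact jn) -(bin_fact mj); lia.
have jmn : (j - m <= n - m)%N by rewrite leq_sub2r.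
have := bin_fact jmn; rewrite (_ : n - m - (j - m) = n - j)%N; last by lia.
by rewrite -(bin_fact mn) => <-; lia.
Qed.

(** By [mul_bin_bin], the quotient of ['C(n, j) * 'C(j, m)] by ['C(n, m)] is ['C(n - m, j - m)];
    what remains is [r ^+ m] times the expansion of [(1 - r + r) ^+ (n - m)]. *)
Lemma binomial_dual_moment (R : realType) (n m : nat) (r : R) : (m <= n)%N ->
  \sum_(j < n.+1) dual_d R n m j * binomial_pmf n r j = r ^+ m.
Proof.
move=> mn.
rewrite -(big_mkord predT (fun j => dual_d R n m j * binomial_pmf n r j)).
rewrite (@big_cat_nat _ _ _ m)//=; last exact: leqW.
rewrite big_nat_cond big1 ?add0r => [|j /andP[/andP[_ jm] _]]; last first.
  by rewrite /dual_d bin_small// !mul0r.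
rewrite -{1}(add0n m) big_addn subSn//.
transitivity (\sum_(0 <= i < (n - m).+1)
    r ^+ m * ((1 - r) ^+ (n - m - i) * r ^+ i *+ 'C(n - m, i))).
  apply: eq_big_nat => i /andP[_]; rewrite ltnS => inm.
  have jn : (m <= i + m <= n)%N by lia.
  rewrite /dual_d /binomial_pmf /unstable.onem -mulr_natr -[in RHS]mulr_natr.
  have /(congr1 (GRing.natmul (1 : R))) := mul_bin_bin jn.
  rewrite addnK !natrM => h.
  have b0 : 'C(n, m)%:R != 0 :> R by rewrite pnatr_eq0 -lt0n bin_gt0.
  apply: (mulIf b0); rewrite exprD (_ : n - (i + m) = n - m - i)%N; last by lia.
  transitivity (r ^+ i * r ^+ m * (1 - r) ^+ (n - m - i) * ('C(n, i + m)%:R * 'C(i + m, m)%:R)).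
    by field.
  by rewrite h; ring.
by rewrite -mulr_sumr big_mkord -exprDn subrK expr1n mulr1.
Qed.

Section omega.
Context (R : realType) (S : choiceType) (n : nat).
Implicit Types (eta : Omega S n).

Lemma measurable_coordinate (z : S) (j : 'I_n.+1) :
  measurable [set eta : Omega S n | eta z = j].
Proof. by apply: sub_sigma_algebra; exists z, j. Qed.

Lemma measurable_fun_coordinate (z : S) (g : nat -> R) :
  measurable_fun [set: Omega S n] (fun eta => g (eta z)).
Proof.
move=> _ B mB; rewrite setTI.
have -> : (fun eta : Omega S n => g (eta z)) @^-1` B =
    \bigcup_(j in [set j : 'I_n.+1 | B (g j)]) [set eta : Omega S n | eta z = j].
  apply/seteqP; split => [eta/= Bg|eta [j /= Bj ej]]; last by rewrite /= ej.
  by exists (eta z).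
by apply: fin_bigcup_measurable => // j _; exact: measurable_coordinate.
Qed.

Lemma ptws_nbhs_coordinates (s : seq S)
    (eta : {ptws S -> discrete_topology 'I_n.+1}) :
  nbhs eta [set zeta | forall z, z \in s -> eta z = zeta z].
Proof.
have ? : Filter (nbhs eta) := nbhs_filter eta.
elim: s => [|a s IH]; first by apply: filterS filterT => zeta _ z.
have near_a : nbhs eta [set zeta | eta a = zeta a].
  have := @proj_continuous S (fun=> discrete_topology 'I_n.+1) a eta.
  move=> /(_ [set eta a]) h.
  have {h} : nbhs eta (proj a @^-1` [set eta a]).
    by apply: h; rewrite nbhs_principalE; apply/principal_filterP.
  by apply: filterS => zeta.
apply: filterS (filterI near_a IH) => zeta [ea es] z.
by rewrite inE => /orP[/eqP ->//|]; exact: es.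
Qed.

(** Such a function is locally constant: finitely many coordinates are fixed on a neighbourhood. *)
Lemma cylinder_ccontinuous (f : Omega S n -> R) : cylinder f -> ccontinuous f.
Proof.
move=> [s fs]; rewrite /ccontinuous => eta A /nbhs_singleton Af.
have ? : Filter (nbhs eta) := nbhs_filter eta.
apply: filterS (ptws_nbhs_coordinates s eta) => zeta es.
by rewrite /= -(fs eta zeta es).
Qed.

Local Open Scope ereal_scope.

(** The hypothesis on [nu] gives only probabilities of cylinder events, so every factor is expanded
    over the values of its coordinate. *)
Lemma product_binomial_integral (rho : S -> R) (nu : probability (Omega S n) R)
    (s : seq S) (g : S -> nat -> R) :
    product_binomial rho nu -> (forall z, 0 <= rho z <= 1)%R -> uniq s ->
    (forall z j, 0 <= g z j)%R ->
  \int[nu]_eta (\prod_(z <- s) g z (eta z))%:E =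
  (\prod_(z <- s) \sum_(j < n.+1) g z j * binomial_pmf n (rho z) j)%:E.
Proof.
move=> hnu hrho us g0.
pose m z := (\sum_(j < n.+1) g z j * binomial_pmf n (rho z) j)%R.
(* Sites are moved one by one from [s] to [s2], where their value is fixed by [c]. *)
suff gen (s2 : seq S) (c : S -> 'I_n.+1) : uniq (s ++ s2) ->
    \int[nu]_eta ((\prod_(z <- s) g z (eta z)) * \prod_(z <- s2) (eta z == c z)%:R)%:E =
    ((\prod_(z <- s) m z) * \prod_(z <- s2) binomial_pmf n (rho z) (c z))%:E.
  have := gen [::] (fun=> ord0); rewrite cats0 big_nil mulr1 => <-//.
  by apply: eq_integral => eta _; rewrite big_nil mulr1.
elim: s us s2 c => [_|a s IH /= /andP[as_ us]] s2 c us2.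
  rewrite big_nil mul1r.
  transitivity (\int[nu]_eta (\1_([set eta : Omega S n | forall z, z \in s2 ->
      [set nat_of_ord (c z)] (eta z)]) eta)%:E).
    apply: eq_integral => eta _; rewrite big_nil mul1r; congr (_%:E).
    rewrite indicE; have [h|h] := pselect (forall z, z \in s2 -> nat_of_ord (eta z) = c z).
      rewrite mem_set//.
      by rewrite big1_seq// => z /= zs; rewrite (_ : eta z = c z) ?eqxx//; apply/val_inj/h.
    rewrite memNset//; move: h => /existsNP[z] /not_implyP[zs2 /eqP ez].
    by rewrite (big_rem z)//= (_ : (eta z == c z) = false) ?mul0r//; apply/negbTE.
  have mE : measurable [set eta : Omega S n | forall z, z \in s2 ->
      [set nat_of_ord (c z)] (eta z)].
    rewrite (_ : [set eta | _] = \big[setI/setT]_(z <- s2) [set eta : Omega S n | eta z = c z]).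
      by apply: bigsetI_measurable => z _; exact: measurable_coordinate.
    rewrite -bigcap_seq; apply/seteqP; split => eta /= h z zs; first by apply/val_inj/h.
    by rewrite (h z zs).
  rewrite integral_indic// setIT.
  apply: etrans (hnu s2 (fun z => [set nat_of_ord (c z)]) us2) _.
  rewrite -prodEFin; apply: eq_bigr => z _.
  by rewrite /binomial_prob hrho esum_set1// lee_fin binomial_pmf_ge0.
(* Expands [g a (eta a)] over the values [j] of [eta a]. As [a] is not in [s2], resetting [c] at [a]
   does not affect the sites already moved. *)
transitivity (\int[nu]_eta \sum_(j < n.+1) (g a j)%:E *
    ((\prod_(z <- s) g z (eta z)) *
     \prod_(z <- a :: s2) (eta z == (if z == a then j else c z))%:R)%:E).
  apply: eq_integral => eta _; rewrite big_cons.
  under [RHS]eq_bigr => j _.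
    rewrite big_cons eqxx -EFinM.
    rewrite (_ : (\prod_(z <- s2) _)%R = (\prod_(z <- s2) (eta z == c z)%:R)%R); last first.
      rewrite [LHS]big_seq [RHS]big_seq; apply: eq_bigr => z zs2.
      rewrite ifN//; apply: contraTneq zs2 => ->.
      by move: us2; rewrite mem_cat negb_or => /andP[/andP[]].
    over.
  rewrite sumEFin (bigD1 (eta a))//= eqxx [X in (_ + X)%R]big1 ?addr0; last first.
    by move=> j /negPf ja; rewrite eq_sym ja mulr0n mul0r !mulr0.
  by congr (_%:E); rewrite mulr1n; ring.
rewrite ge0_integral_sum//; last 2 first.
- move=> j; apply/measurable_EFinP; apply: measurable_funM; first exact: measurable_cst.
  apply: measurable_funM; apply: measurable_prod => z _.
    exact: measurable_fun_coordinate.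
  exact: (@measurable_fun_coordinate z (fun l => (l == (if z == a then j else c z))%:R)).
- by move=> j eta _; rewrite -EFinM lee_fin !mulr_ge0 ?prodr_ge0.
transitivity (\sum_(j < n.+1) (g a j)%:E * ((\prod_(z <- s) m z) *
    (binomial_pmf n (rho a) j * \prod_(z <- s2) binomial_pmf n (rho z) (c z)))%:E).
  apply: eq_bigr => j _; rewrite ge0_integralZl//; last 3 first.
  - apply/measurable_EFinP.
    apply: measurable_funM; apply: measurable_prod => z _.
      exact: measurable_fun_coordinate.
    exact: (@measurable_fun_coordinate z (fun l => (l == (if z == a then j else c z))%:R)).
  - by move=> eta _; rewrite lee_fin !mulr_ge0 ?prodr_ge0.
  - by rewrite lee_fin.
  rewrite (IH us (a :: s2) (fun z => if z == a then j else c z)); last first.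
    by rewrite -[a :: s2]cat1s uniq_catCA cat1s.
  rewrite big_cons eqxx; congr (_ * (_ * (_ * _))%:E).
  rewrite [LHS]big_seq [RHS]big_seq; apply: eq_bigr => z zs2.
  rewrite ifN//; apply: contraTneq zs2 => ->.
  by move: us2; rewrite mem_cat negb_or => /andP[/andP[]].
under [LHS]eq_bigr do rewrite -EFinM.
rewrite sumEFin big_cons {2}/m mulr_suml mulr_suml; congr (_%:E).
by apply: eq_bigr => j _; ring.
Qed.

End omega.

(** * Time derivatives of moments *)

Section uniform_right_derivative.
Context (R : realType).
Implicit Types (u G : R -> R).

(* As the estimate is uniform in the base point, it controls the difference
   quotients on the left of t as well, based at [t + h] with [h < 0]. *)
Lemma is_derive_uniform_right u G (t : R) : 0 < t ->
    (forall e : R, 0 < e -> exists2 d : R, 0 < d & forall s h : R, 0 <= s -> 0 < h < d ->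
      `|u (s + h) - u s - h * G s| <= e * h) ->
    {for t, continuous G} ->
  is_derive t 1 u (G t).
Proof.
move=> t0 uG Gt.
suff cv : h^-1 *: ((u \o shift t) (h *: (1 : R)) - u t) @[h --> (0 : R)^'] --> G t.
  by apply: DeriveDef; [apply/cvg_ex; exists (G t)|exact: cvg_lim].
apply/cvgrPdist_le => e e0.
have e20 : 0 < e / 2 by rewrite divr_gt0.
have [d d0 ud] := uG _ e20.
have [r /= r0 Gr] : \forall s \near t, `|G t - G s| <= e / 2.
  by move/cvgrPdist_le : Gt; exact.
have key s h : 0 <= s -> 0 < h < d -> `|G s - h^-1 * (u (s + h) - u s)| <= e / 2.
  move=> s0 hd; have /andP[h0 _] := hd.
  have := ud s h s0 hd; rewrite -ler_pdivrMr//; apply: le_trans.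
  rewrite -[X in _ <= _ / X](gtr0_norm h0) -normf_div distrC.
  by rewrite le_eqVlt; apply/orP; left; apply/eqP; congr `|_|; field; rewrite gt_eqF.
exists (Num.min d (Num.min t r)); first by rewrite /= !lt_min d0 t0 r0.
move=> h /=; rewrite sub0r normrN !lt_min => /and3P[hd ht hr] h0.
rewrite /GRing.scale/= mulr1.
have [h_gt0|h_le0] := ltP 0 h.
  rewrite (addrC h) (le_trans (key t h (ltW t0) _))//.
    by rewrite h_gt0 (le_lt_trans (ler_norm _)).
  by lra.
have h_lt0 : h < 0 by rewrite lt_neqAle h0.
rewrite ltr0_norm// in hd ht.
have th0 : 0 <= t + h by lra.
have := key (t + h) (- h) th0; rewrite oppr_gt0 h_lt0 hd => /(_ isT).
rewrite addrK invrN mulNr -mulrN opprB => h1.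
have h2 : `|G t - G (t + h)| <= e / 2.
  by apply: Gr; rewrite /= opprD addrA subrr sub0r normrN.
rewrite (addrC h).
have -> : G t - h^-1 * (u (t + h) - u t) =
  (G t - G (t + h)) + (G (t + h) - h^-1 * (u (t + h) - u t)) by ring.
by rewrite (le_trans (ler_normD _ _))//; lra.
Qed.

(** Clamping the time at 0 gives a function on the whole line although the bound has only
    nonnegative base points; continuity on [[0, T]] and at each [t > 0] can then be read off. *)
Lemma right_lipschitz_continuous u (d C : R) : 0 < d ->
    (forall s h : R, 0 <= s -> 0 < h < d -> `|u (s + h) - u s| <= C * h) ->
  continuous (fun t : R => u (Num.max 0 t)).
Proof.
move=> d0 ud t; apply/cvgrPdist_le => e e0.
(* [C] is not assumed positive; [|C| + 1] is a Lipschitz constant by which one can divide. *)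
have C0 : 0 < `|C| + 1 by rewrite ltr_wpDl.
have max_gap (a b : R) : a <= b -> `|b - a| < d ->
    `|u (Num.max 0 b) - u (Num.max 0 a)| <= (`|C| + 1) * `|b - a|.
  move=> ab abd; pose a' := Num.max 0 a; pose b' := Num.max 0 b.
  have a'0 : 0 <= a' by rewrite /a' le_max lexx.
  have bb' : a' <= b' by rewrite /a' /b' ge_max !le_max lexx ab orbT.
  have ab' : b' - a' <= b - a.
    by rewrite /a' /b'; case: (leP 0 a); case: (leP 0 b); lra.
  have nab : `|b - a| = b - a by rewrite ger0_norm ?subr_ge0.
  rewrite nab in abd *; rewrite -/a' -/b'.
  have [->|ne] := eqVneq b' a'.
    by rewrite subrr normr0 mulr_ge0 ?subr_ge0 ?(ltW C0).
  have lt' : a' < b' by rewrite lt_neqAle eq_sym ne.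
  have := ud a' (b' - a') a'0; rewrite subrKC subr_gt0 lt' (le_lt_trans ab' abd).
  move=> /(_ isT) /le_trans; apply.
  have Cle : C <= `|C| + 1 by rewrite (le_trans (ler_norm _))// lerDl.
  by rewrite (@le_trans _ _ ((`|C| + 1) * (b' - a')))// ?ler_wpM2r ?ler_wpM2l// ?subr_ge0// ltW.
exists (Num.min d (e / (`|C| + 1))); first by rewrite /= lt_min d0 divr_gt0.
move=> s /=; rewrite lt_min => /andP[sd se].
apply: (@le_trans _ _ ((`|C| + 1) * `|t - s|)); last first.
  by rewrite mulrC -ler_pdivlMr// ltW.
have [st|/ltW ts] := leP s t; first exact: max_gap.
by rewrite distrC [in leRHS]distrC; apply: max_gap => //; rewrite distrC.
Qed.

Lemma within_continuous_maxr u (T : R) :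
  continuous (fun t : R => u (Num.max 0 t)) -> {within `[0, T], continuous u}.
Proof.
move=> uc; apply: (@subspace_eq_continuous _ _ _ (fun t : R => u (Num.max 0 t))).
  by move=> t; rewrite inE/= in_itv/= => /andP[t0 _]; rewrite max_r.
exact: continuous_subspaceT.
Qed.

Lemma continuous_at_maxr u (t : R) : 0 < t ->
  continuous (fun t : R => u (Num.max 0 t)) -> {for t, continuous u}.
Proof.
move=> t0 /(_ t); rewrite /= /continuous_at max_r ?(ltW t0)// => uc.
apply: cvg_trans uc; apply: near_eq_cvg.
near=> s; rewrite max_r//; near: s.
exists t => //= s /=; rewrite ltr_norml => /andP[? ?]; lra.
Unshelve. all: by end_near. Qed.

End uniform_right_derivative.

(** * Bounded integrands and mixtures of probability measures *)

Section probability_integral.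
Context d (T : measurableType d) (R : realType) (m : {measure set T -> \bar R}).
Hypothesis m1 : m [set: T] = 1%E.

Lemma bounded_integrable (f : T -> R) (C : R) : measurable_fun setT f ->
  (forall x, `|f x| <= C) -> m.-integrable setT (EFin \o f).
Proof.
move=> mf fC; apply: measurable_bounded_integrable => //.
  by rewrite m1 ltry.
exists C; split; first exact: num_real.
by move=> M CM x _ /=; rewrite (le_trans (fC x))// ltW.
Qed.

Lemma EFin_Rintegral (f : T -> R) (C : R) : measurable_fun setT f ->
  (forall x, `|f x| <= C) -> (\int[m]_x f x)%:E = (\int[m]_x (f x)%:E)%E.
Proof.
move=> mf fC; rewrite /Rintegral fineK//.
by apply: integrable_fin_num => //; exact: bounded_integrable fC.
Qed.

Lemma Rintegral_prob_le (f : T -> R) (C : R) : measurable_fun setT f ->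
  (forall x, `|f x| <= C) -> `|\int[m]_x f x| <= C.
Proof.
move=> mf fC; have fi := bounded_integrable mf fC.
rewrite (le_trans (le_normr_Rintegral _ fi))//.
have -> : C = \int[m]_x C.
  by rewrite Rintegral_cst// m1 mulr1.
apply: le_Rintegral => //.
  apply: (@bounded_integrable (fun x => `|f x|) C).
    exact: measurableT_comp.
  by move=> x; rewrite normr_id.
by apply: (@bounded_integrable (cst C) `|C|) => //; exact: measurable_cst.
Qed.

Lemma Rintegral_sum (I : Type) (s : seq I) (F : I -> T -> R) :
    (forall i, m.-integrable setT (EFin \o F i)) ->
  \int[m]_x (\sum_(i <- s) F i x) = \sum_(i <- s) \int[m]_x F i x.
Proof.
move=> Fi; rewrite /Rintegral; under eq_integral do rewrite -sumEFin.
rewrite integral_sum//.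
have Fin i : (\int[m]_x (F i x)%:E)%E \is a fin_num by exact: integrable_fin_num (Fi i).
by under eq_bigr do rewrite -(fineK (Fin _)); rewrite sumEFin.
Qed.

End probability_integral.

(** With [mu] seen as a constant kernel from the one-point space, [m] is a composition of
    kernels. *)
Lemma ge0_integral_mixture d d' (X : measurableType d) (Y : measurableType d')
    (R : realType) (mu : probability X R) (k : R.-pker X ~> Y)
    (m : {measure set Y -> \bar R}) (f : Y -> \bar R) :
    (forall A, measurable A -> m A = (\int[mu]_x k x A)%E) ->
    (forall y, 0 <= f y)%E -> measurable_fun setT f ->
  (\int[m]_y f y = \int[mu]_x \int[k x]_y f y)%E.
Proof.
move=> mE f0 mf.
pose l := kprobability (measurable_cst (mu : pprobability X R) : measurable_fun [set: unit] _).
pose k' : unit * X -> {measure set Y -> \bar R} := kernel.kernel_snd k.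
transitivity (\int[kcomp l k' tt]_y f y)%E.
  by apply: eq_measure_integral => A mA _; rewrite mE.
by rewrite integral_kcomp.
Qed.

Section tupleD_theory.
Context (R : realType) (S : choiceType) (n k : nat).
Implicit Types (x : 'I_k -> S) (eta : Omega S n).

Lemma tupleDE x eta : tupleD R x eta =
  \prod_(z <- undup (codom x)) dual_d R n (occ x z) (eta z).
Proof.
apply: dual_D_seq; first exact: undup_uniq.
by move=> z /occ_neq0[i <-]; rewrite mem_undup codom_f.
Qed.

Lemma tupleD_ge0 x eta : 0 <= tupleD R x eta.
Proof. by rewrite tupleDE prodr_ge0// => z _; exact: dual_d_ge0. Qed.

Lemma tupleD_le1 x eta : tupleD R x eta <= 1.
Proof.
rewrite tupleDE; apply: prodr_ile1 => z _.
by rewrite dual_d_ge0 dual_d_le1// -ltnS ltn_ord.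
Qed.

Lemma normr_tupleD x eta : `|tupleD R x eta| <= 1.
Proof. by rewrite ger0_norm ?tupleD_ge0// tupleD_le1. Qed.

Lemma measurable_tupleD x : measurable_fun [set: Omega S n] (tupleD R x).
Proof.
rewrite (_ : tupleD R x = fun eta => \prod_(z <- undup (codom x))
    dual_d R n (occ x z) (eta z)); last by apply/funext => eta; exact: tupleDE.
apply: measurable_prod => z _.
exact: (measurable_fun_coordinate z (dual_d R n (occ x z))).
Qed.

Lemma cylinder_tupleD x : cylinder (tupleD R x : Omega S n -> R).
Proof.
exists (undup (codom x)) => eta zeta h; rewrite !tupleDE.
by rewrite [LHS]big_seq [RHS]big_seq; apply: eq_bigr => z /h ->.
Qed.

End tupleD_theory.

Section sep_moments.
Context (R : realType) (S : choiceType) (n : nat) (p : S -> S -> R)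
  (nb : S -> seq S) (P : R -> R.-pker Omega S n ~> Omega S n)
  (nu : probability (Omega S n) R).
Hypotheses (hp : local_walk p nb) (hP : sep_process p P).

Lemma integral_law_after0 (f : Omega S n -> \bar R) :
  (\int[law_after nu (P 0)]_eta f eta = \int[nu]_eta f eta)%E.
Proof.
apply: eq_measure_integral => A mA _; rewrite /= /law_after.
transitivity (\int[nu]_eta (\1_A eta)%:E)%E; last by rewrite integral_indic// setIT.
apply: eq_integral => eta _.
by rewrite (sep_start hP)// diracE indicE.
Qed.

Lemma integral_law_afterD (s t : R) (f : Omega S n -> \bar R) :
    0 <= s -> 0 <= t -> (forall eta, 0 <= f eta)%E -> measurable_fun setT f ->
  (\int[law_after nu (P (s + t))]_eta f eta =
   \int[law_after nu (P s)]_eta \int[P t eta]_zeta f zeta)%E.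
Proof.
move=> s0 t0 f0 mf; apply: ge0_integral_mixture => // A mA.
rewrite (ge0_integral_mixture (mu := nu) (k := P s))//; last exact: measurable_kernel.
apply: eq_integral => eta _.
exact: (sep_markov hP eta s0 t0 mA).
Qed.

Section moment.
Context (k : nat).
Implicit Types (x : 'I_k -> S).

Definition moment (t : R) x : R := \int[law_after nu (P t)]_eta tupleD R x eta.

Lemma moment_ge0 t x : 0 <= moment t x.
Proof. by apply: Rintegral_ge0 => eta _; exact: tupleD_ge0. Qed.

Lemma normr_moment t x : `|moment t x| <= 1.
Proof.
exact: (Rintegral_prob_le (probability_setT (law_after nu (P t)))
  (measurable_tupleD x) (normr_tupleD R x)).
Qed.

Lemma EFin_semigroup h x eta :
  (semigroup P h (tupleD R x) eta)%:E = (\int[P h eta]_zeta (tupleD R x zeta)%:E)%E.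
Proof.
exact: (EFin_Rintegral (@prob_kernel _ _ _ _ _ (P h) eta) (measurable_tupleD x) (normr_tupleD R x)).
Qed.

Lemma normr_semigroup h x eta : `|semigroup P h (tupleD R x) eta| <= 1.
Proof.
exact: (Rintegral_prob_le (@prob_kernel _ _ _ _ _ (P h) eta)
  (measurable_tupleD x) (normr_tupleD R x)).
Qed.

Lemma measurable_semigroup h x :
  measurable_fun setT (semigroup P h (tupleD R x)).
Proof.
apply/measurable_EFinP.
rewrite (_ : EFin \o _ = fun eta => (\int[P h eta]_zeta (tupleD R x zeta)%:E)%E).
  apply: measurable_fun_integral_kernel.
  - by move=> U mU; exact: measurable_kernel.
  - by move=> zeta; rewrite lee_fin tupleD_ge0.
  - by apply/measurable_EFinP; exact: measurable_tupleD.
by apply/funext => eta; exact: EFin_semigroup.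
Qed.

Lemma momentD t h x : 0 <= t -> 0 <= h ->
  moment (t + h) x = \int[law_after nu (P t)]_eta semigroup P h (tupleD R x) eta.
Proof.
move=> t0 h0; rewrite /moment /Rintegral integral_law_afterD//.
- by congr fine; apply: eq_integral => eta _; rewrite -EFin_semigroup.
- by move=> eta; rewrite lee_fin tupleD_ge0.
- by apply/measurable_EFinP; exact: measurable_tupleD.
Qed.

(** [tupleD R x] is a cylinder function, so the constant sequence puts it in the closure and hence
    in the domain of the generator. Convergence there is uniform in [eta], and duality rewrites the
    limit. *)
Lemma semigroup_generator x : admissible n x ->
  forall e : R, 0 < e -> exists2 d : R, 0 < d & forall h eta, 0 < h < d ->
    `|semigroup P h (tupleD R x) eta - tupleD R x eta -
      h * sep_dual n p nb (fun y => tupleD R y eta) x| <= e * h.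
Proof.
move=> adx e e0.
have Dc := cylinder_tupleD R n x.
have gen : in_generator P (tupleD R x) (sep_generator p (tupleD R x)).
  apply/(sep_has_generator hP _ (cylinder_ccontinuous Dc)).
  exists (fun=> tupleD R x).
  split; first by move=> j; exact: Dc.
    by move=> A /nbhs_singleton fA; exists 0%N.
  by move=> A /nbhs_singleton fA; exists 0%N.
pose g : Omega S n -> R := sep_generator p (tupleD R x).
have : nbhs (g : {uniform Omega S n -> R})
    [set f : Omega S n -> R | forall eta, ball (g eta) e (f eta)].
  apply/uniform_nbhs; exists [set ab | ball ab.1 e ab.2]; split.
    exact: entourage_ball (PosNum e0).
  by move=> f /= fe eta; exact: fe.
move=> /gen[d /= d0 hd]; exists d => // h eta /andP[h0 hlt].
have := hd h; rewrite /= sub0r normrN gtr0_norm// => /(_ hlt h0 eta).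
rewrite /ball/= /g (sep_generator_duality hp)// => /ltW.
rewrite -(ler_pM2r h0); apply: le_trans.
rewrite -[X in _ <= _ * X](gtr0_norm h0) -normrM distrC.
by rewrite le_eqVlt; apply/orP; left; apply/eqP; congr `|_|; field; rewrite gt_eqF.
Qed.

Lemma sep_dual_moment t x :
  \int[law_after nu (P t)]_eta sep_dual n p nb (fun y => tupleD R y eta) x =
  sep_dual n p nb (moment t) x.
Proof.
pose m : probability (Omega S n) R := law_after nu (P t).
have m1 : m setT = 1%E by exact: probability_setT.
have Di y : m.-integrable setT (EFin \o tupleD R (y : 'I_k -> S)).
  exact (bounded_integrable m1 (measurable_tupleD y) (normr_tupleD R y)).
have mT c y : measurable_fun [set: Omega S n]
    (fun eta => c * (tupleD R (y : 'I_k -> S) eta - tupleD R x eta)).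
  apply: measurable_funM; first exact: measurable_cst.
  by apply: measurable_funB; exact: measurable_tupleD.
have Ti c y : m.-integrable setT
    (EFin \o (fun eta => c * (tupleD R (y : 'I_k -> S) eta - tupleD R x eta))).
  apply: (bounded_integrable (C := `|c| * 2) m1 (mT c y)) => eta.
  rewrite normrM ler_wpM2l// (le_trans (ler_normB _ _))//.
  have := normr_tupleD R y eta; have := normr_tupleD R x eta; lra.
have Tint c y : \int[m]_eta (c * (tupleD R (y : 'I_k -> S) eta - tupleD R x eta)) =
    c * (moment t y - moment t x).
  rewrite RintegralZl//; first by rewrite RintegralB.
  by have := Ti 1 y; congr (integrable _ _ _); apply/funext => eta /=; rewrite mul1r.
rewrite /sep_dual Rintegral_sum => [|i]; last first.
  rewrite (_ : EFin \o _ = (fun eta => \sum_(y <- nb (x i))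
      (EFin \o (fun eta : Omega S n => (n - occ x y)%:R * p (x i) y *
      (tupleD R (jump x i y) eta - tupleD R x eta))%R) eta)%E).
    by apply: integrable_sum => // y _; exact: Ti.
  by apply/funext => eta /=; rewrite sumEFin.
apply: eq_bigr => i _; rewrite Rintegral_sum => [|y]; last exact: Ti.
by apply: eq_bigr => y _; exact: Tint.
Qed.

(** The Markov property at time [t] leaves an evolution over time [h] only; [d] is independent of
    [t] because [semigroup_generator] is uniform in the configuration. *)
Lemma moment_right_derivative x : admissible n x ->
  forall e : R, 0 < e -> exists2 d : R, 0 < d & forall t h, 0 <= t -> 0 < h < d ->
    `|moment (t + h) x - moment t x - h * sep_dual n p nb (moment t) x| <= e * h.
Proof.
move=> adx e e0; have [d d0 hd] := semigroup_generator adx e0.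
exists d => // t h t0 h0d; have /andP[h0 _] := h0d.
pose m : probability (Omega S n) R := law_after nu (P t).
have m1 : m setT = 1%E by exact: probability_setT.
pose g (eta : Omega S n) := sep_dual n p nb (fun y => tupleD R y eta) x.
have mg : measurable_fun [set: Omega S n] g.
  apply: measurable_sum => i; apply: measurable_sum => y.
  apply: measurable_funM; first exact: measurable_cst.
  by apply: measurable_funB; exact: measurable_tupleD.
have gb eta : `|g eta| <= (k * n)%:R * (1 *+ 2).
  by apply: normr_sep_dual => // y; exact: normr_tupleD.
have gi := bounded_integrable m1 mg gb.
have Si : m.-integrable setT (EFin \o semigroup P h (tupleD R x)).
  exact (bounded_integrable m1 (measurable_semigroup h x) (normr_semigroup h x)).
have Di : m.-integrable setT (EFin \o tupleD R x).
  exact (bounded_integrable m1 (measurable_tupleD x) (normr_tupleD R x)).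
have SDi : m.-integrable setT
    (EFin \o (fun eta => semigroup P h (tupleD R x) eta - tupleD R x eta)).
  exact (integrableB measurableT Si Di).
have hgi : m.-integrable setT (EFin \o (fun eta => h * g eta)).
  exact (integrableZl measurableT h gi).
have -> : moment (t + h) x - moment t x - h * sep_dual n p nb (moment t) x =
    \int[m]_eta (semigroup P h (tupleD R x) eta - tupleD R x eta - h * g eta).
  rewrite (RintegralB measurableT SDi hgi); congr (_ - _).
    by rewrite (RintegralB measurableT Si Di) (momentD _ t0 (ltW h0)).
  by rewrite -sep_dual_moment; exact (esym (RintegralZl h measurableT gi)).
apply: (Rintegral_prob_le m1).
  apply: measurable_funB; last by apply: measurable_funM => //; exact: measurable_cst.
  by apply: measurable_funB; [exact: measurable_semigroup|exact: measurable_tupleD].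
by move=> eta; exact: hd.
Qed.

Lemma moment_maxr_continuous x : admissible n x ->
  continuous (fun t : R => moment (Num.max 0 t) x).
Proof.
move=> adx; have [d d0 hd] := moment_right_derivative adx ltr01.
(* The first summand bounds [sep_dual] of a function with values in [-1, 1]; the 1 is the error at
   [e = 1]. *)
apply: (@right_lipschitz_continuous _ (moment ^~ x) d ((k * n)%:R * (1 *+ 2) + 1)) => //.
move=> t h t0 h0d; have := hd t h t0 h0d; have /andP[h0 _] := h0d.
have := normr_sep_dual n hp x (normr_moment t).
move: (sep_dual _ _ _ _ _) (_ * _%:R) (moment (t + h) x - moment t x) => G C D GC hG.
have -> : D = (D - h * G) + h * G by ring.
rewrite (le_trans (ler_normD _ _))// mulrDl addrC lerD// normrM (gtr0_norm h0).
by rewrite mulrC ler_wpM2r// ltW.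
Qed.

Lemma is_derive_moment x (t : R) : admissible n x -> 0 < t ->
  is_derive t 1 (moment ^~ x) (sep_dual n p nb (moment t) x).
Proof.
move=> adx t0.
apply: (@is_derive_uniform_right _ (moment ^~ x)
  (fun s => sep_dual n p nb (moment s) x) t t0 (moment_right_derivative adx)).
have mc y : admissible n y -> {for t, continuous (moment ^~ y)}.
  move=> ady; exact: continuous_at_maxr t0 (moment_maxr_continuous ady).
rewrite /prop_for /continuous_at /sep_dual.
apply: (@cvg_big R^o _ +%R 0 xpredT (@add_continuous R^o)) => i _.
apply: (@cvg_big R^o _ +%R 0 xpredT (@add_continuous R^o)) => y _.
(* A jump onto a full site may give an inadmissible tuple, whose moment is not known to be
   continuous; its rate is 0. *)
have [xyn|] := ltnP (occ x y) n; last first.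
  rewrite -subn_eq0 => /eqP ->; rewrite !mul0r.
  by under eq_fun do rewrite !mul0r; exact: cvg_cst.
apply: cvgM; first exact: cvg_cst.
by apply: cvgB; apply: mc => //; exact: admissible_jump.
Qed.

Lemma moment0 (rho : S -> R) x : product_binomial rho nu ->
    (forall z, 0 <= rho z <= 1) -> admissible n x ->
  moment 0 x = \prod_(i < k) rho (x i).
Proof.
move=> hnu hrho adx; rewrite /moment /Rintegral integral_law_after0.
under eq_integral do rewrite tupleDE.
rewrite (product_binomial_integral (g := fun z j => dual_d R n (occ x z) j)
  hnu hrho (undup_uniq _))/=; last by move=> z j; exact: dual_d_ge0.
(* The power of [rho z] is split over particles, so that exchanging the products leaves one factor
   per particle. *)
under eq_bigr => z _ do rewrite binomial_dual_moment// /occ -prodrXr.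
rewrite exchange_big/=; apply: eq_bigr => i _.
rewrite (bigD1_seq (x i))/= ?undup_uniq ?mem_undup ?codom_f// eqxx expr1.
by rewrite big1 ?mulr1// => z /negPf zx; rewrite eq_sym zx expr0.
Qed.

End moment.
End sep_moments.

(** * Negative correlations *)

Lemma admissible_cst (S : choiceType) (n : nat) (a : S) : (0 < n)%N ->
  admissible n (fun _ : 'I_1 => a).
Proof. by move=> n0 z; rewrite /occ big_ord1; apply: leq_trans n0; case: (a == z). Qed.

Lemma moment_le_prod (R : realType) (S : choiceType) (n k : nat) (p : S -> S -> R)
    (nb : S -> seq S) (P : R -> R.-pker Omega S n ~> Omega S n)
    (nu : probability (Omega S n) R) (rho : S -> R) (t : R) (x : 'I_k -> S) :
    (0 < n)%N -> local_walk p nb -> sep_process p P ->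
    product_binomial rho nu -> (forall z, 0 <= rho z <= 1) -> 0 <= t ->
    admissible n x ->
  moment P nu t x <= \prod_(i < k) moment P nu t (fun _ : 'I_1 => x i).
Proof.
move=> n0 hp hP hnu hrho t0 adx.
have ad1 (a : S) := admissible_cst a n0.
apply: (correlation_comparison hp (f := fun s a => moment P nu s (fun _ : 'I_1 => a))) => //.
- by move=> s y _; rewrite (le_trans (ler_norm _))// normr_moment.
- by move=> s a _; exact: moment_ge0.
- by move=> y T ady; exact: (@within_continuous_maxr _ (fun s => moment P nu s y) T
    (moment_maxr_continuous hp hP ady)).
- by move=> a T; exact: (@within_continuous_maxr _ (fun s => moment P nu s (fun _ : 'I_1 => a)) T
    (moment_maxr_continuous hp hP (ad1 a))).
- by move=> y s ady s0; exact: is_derive_moment.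
(* A lone particle meets no exclusion: the only occupied site is [a], and [p a a = 0]. *)
- move=> a s s0; suff <- : sep_dual n p nb (moment P nu s) (fun _ : 'I_1 => a) =
      walk_generator n p nb (fun b => moment P nu s (fun _ : 'I_1 => b)) a.
    exact: is_derive_moment.
  rewrite /sep_dual big_ord1 /walk_generator mulr_sumr; apply: eq_bigr => y _.
  have [<-|ay] := eqVneq a y; first by rewrite (lw_diag hp) !(mulr0, mul0r).
  have -> : jump (fun _ : 'I_1 => a) ord0 y = fun=> y.
    by apply/funext => i; rewrite /jump ord1 eqxx.
  by rewrite /occ big_ord1 (negPf ay) subn0 mulrA.
- move=> y ady; rewrite (moment0 hP hnu hrho ady); apply: eq_bigr => i _.
  by rewrite (moment0 hP hnu hrho (ad1 _)) big_ord1.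
Qed.

Lemma particles_occ (S : choiceType) (k : nat) (x : k.-tuple S) :
  particles x = occ (tnth x).
Proof. by apply/funext => z; rewrite /particles /occ big_tuple. Qed.

Lemma particles_mem (S : choiceType) (xs : seq S) (z : S) :
  (particles xs z != 0)%N -> z \in xs.
Proof.
apply: contraNT => zs; rewrite /particles big1_seq// => y /= ys.
by apply/eqP; rewrite eqb0; apply: contraNneq zs => <-.
Qed.

(** * Finite neighbourhoods of the random walks *)

Section locally_finite_walk.
Context (R : realType) (S : choiceType) (p : S -> S -> R).

Lemma irreducible_local_walk : irreducible_symmetric p ->
    (forall x, finite_set [set y | p x y != 0]) ->
  local_walk p (fun x => finmap.enum_fset (fset_set [set y | p x y != 0])).
Proof.
move=> [psym p0 p1 pd _] pfin; split=> // x.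
- move=> y pxy; rewrite in_fset_set//; exact/mem_set.
- have := p1 x; rewrite (esumID [set y | p x y != 0]); last by move=> y _; rewrite lee_fin.
  rewrite [X in (_ + X)%E]esum1 ?adde0; last first.
    by move=> y [_] /= /negP; rewrite negbK => /eqP ->.
  rewrite setTI esum_fset//; last by move=> y _; rewrite lee_fin.
  by rewrite fsbig_finite//= sumEFin => -[].
Qed.

End locally_finite_walk.

Lemma finite_range_support (R : realType) (d : nat)
    (p : 'rV[int]_d -> 'rV[int]_d -> R) (x : 'rV[int]_d) :
  finite_range p -> finite_set [set y | p x y != 0].
Proof.
move=> [r hr].
(* Each coordinate of the displacement lies between [-r] and [r]; adding [r] encodes it in
   ['I_(r + r).+1]. *)
pose f (v : {ffun 'I_d -> 'I_(r + r).+1}) : 'rV[int]_d :=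
  \row_i (x ord0 i + (v i)%:Z - r%:Z).
apply: (@sub_finite_set _ _ (f @` [set: {ffun 'I_d -> 'I_(r + r).+1}])); last first.
  exact/finite_image/finite_finset.
move=> y /= /hr xy.
exists [ffun i => inord (absz (y ord0 i - x ord0 i + r%:Z))] => //.
apply/rowP => i; rewrite mxE ffunE; have := xy i; move: (y _ i) (x _ i) => a b ab.
by rewrite inordK; lia.
Qed.

Lemma random_walk_local (R : realType) (G : site_space)
    (p : site G -> site G -> R) :
  random_walk p -> exists nb, local_walk p nb.
Proof.
case: G p => [T|d] p /=.
  move=> pi; exists (fun x => finmap.enum_fset (fset_set [set y | p x y != 0])).
  by apply: irreducible_local_walk => // x; exact: finite_finset.
move=> [pi _ pr]; exists (fun x => finmap.enum_fset (fset_set [set y | p x y != 0])).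
by apply: irreducible_local_walk => // x; exact: finite_range_support.
Qed.

Section pair_correlation.
Context (R : realType) (S : choiceType) (n : nat) (m : probability (Omega S n) R).
Hypothesis n0 : (0 < n)%N.

Let cnt (x : S) (eta : Omega S n) : R := (nat_of_ord (eta x))%:R.

Let cnt_le x eta : `|cnt x eta| <= n%:R.
Proof. by rewrite ger0_norm// ler_nat -ltnS ltn_ord. Qed.

Let measurable_cnt x : measurable_fun [set: Omega S n] (cnt x).
Proof. exact: (measurable_fun_coordinate x (fun j => j%:R)). Qed.

Let measurable_cntM x y : measurable_fun [set: Omega S n] (fun eta => cnt x eta * cnt y eta).
Proof. exact: measurable_funM. Qed.

Let cntM_le x y eta : `|cnt x eta * cnt y eta| <= n%:R * n%:R.
Proof. by rewrite normrM ler_pM. Qed.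

(** For distinct sites the duality function is the product of the two particle numbers divided by
    [n ^ 2]; for equal sites it would be a factorial moment. *)
Lemma covariance_K (x y : S) : x != y ->
  covariance m (cnt x) (cnt y) =
  (n%:R ^+ 2 * (K m [:: x; y] - K m [:: x] * K m [:: y]))%:E.
Proof.
move=> xy; have nn : n%:R != 0 :> R by rewrite pnatr_eq0 -lt0n.
have m1 : m setT = 1%E by exact: probability_setT.
have K1 z : K m [:: z] = n%:R^-1 * \int[m]_eta cnt z eta.
  rewrite -RintegralZl//; last exact (bounded_integrable m1 (measurable_cnt z) (cnt_le z)).
  apply: eq_Rintegral => eta _; rewrite (@dual_D_seq _ _ _ _ _ [:: z])//.
    by rewrite big_seq1 /particles big_seq1 eqxx dual_d1 mulrC.
  by move=> w; exact: particles_mem.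
have K2 : K m [:: x; y] = n%:R^-1 ^+ 2 * \int[m]_eta (cnt x eta * cnt y eta).
  rewrite -RintegralZl//; last exact (bounded_integrable m1 (measurable_cntM x y) (cntM_le x y)).
  apply: eq_Rintegral => eta _; rewrite (@dual_D_seq _ _ _ _ _ [:: x; y])//=.
  - rewrite big_cons big_seq1 /particles !big_cons !big_nil !eqxx eq_sym (negPf xy).
    by rewrite !dual_d1 /cnt; field.
  - by rewrite inE xy.
  - by move=> w; exact: particles_mem.
rewrite covarianceE.
- rewrite !unlock -(EFin_Rintegral m1 (measurable_cnt x) (cnt_le x)).
  rewrite -(EFin_Rintegral m1 (measurable_cnt y) (cnt_le y)).
  rewrite -(EFin_Rintegral m1 (measurable_cntM x y) (cntM_le x y)).
  by rewrite -EFinM -EFinB !K1 K2; congr (_%:E); field.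
- apply/Lfun1_integrable; exact (bounded_integrable m1 (measurable_cnt x) (cnt_le x)).
- apply/Lfun1_integrable; exact (bounded_integrable m1 (measurable_cnt y) (cnt_le y)).
- apply/Lfun1_integrable; exact (bounded_integrable m1 (measurable_cntM x y) (cntM_le x y)).
Qed.

End pair_correlation.

Theorem proposition3 (R : realType) (G : site_space) (n : nat)
    (hn : (1 <= n)%N)
    (p : site G -> site G -> R) (hp : random_walk p)
    (P : R -> R.-pker Omega (site G) n ~> Omega (site G) n)
    (hP : sep_process p P)
    (rho : site G -> R) (hrho : forall x, 0 <= rho x <= 1)
    (nu : probability (Omega (site G) n) R) (hnu : product_binomial rho nu)
    (t : R) (ht : 0 < t) :
  (forall (k : nat) (x : k.-tuple (site G)), (1 <= k)%N ->
     (forall z, (particles x z <= n)%N) ->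
     K (law_after nu (P t)) x <=
     \prod_(i < k) K (law_after nu (P t)) [:: tnth x i]) /\
  (forall x y : site G, x != y ->
     (covariance (law_after nu (P t))
        (fun eta => (nat_of_ord (eta x))%:R)
        (fun eta => (nat_of_ord (eta y))%:R) <= 0)%E).
Proof.
have [nb hnb] := random_walk_local hp.
have K_moment k (x : k.-tuple (site G)) :
    K (law_after nu (P t)) x = moment P nu t (tnth x).
  by rewrite /K particles_occ.
have corr k (x : k.-tuple (site G)) : (forall z, (particles x z <= n)%N) ->
    K (law_after nu (P t)) x <= \prod_(i < k) K (law_after nu (P t)) [:: tnth x i].
  move=> adx; rewrite K_moment.
  apply: le_trans (moment_le_prod hn hnb hP hnu hrho (ltW ht) _) _.
    by move=> z; rewrite -particles_occ.
  rewrite le_eqVlt; apply/orP; left; apply/eqP; apply: eq_bigr => i _.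
  rewrite (K_moment 1%N [tuple tnth x i]); congr (moment _ _ _ _).
  by apply/funext => j; rewrite ord1 tnth0.
split=> [k x _|x y xy]; first exact: corr.
rewrite covariance_K// lee_fin pmulr_rle0 ?exprn_gt0 ?ltr0n// subr_le0.
(* As [x != y], each site occurs at most once, so [1 <= n] makes the pair admissible. *)
have := corr 2 [tuple x; y]; rewrite !big_ord_recl big_ord0 mulr1; apply => z.
rewrite /particles !big_cons big_nil addn0 (leq_trans _ hn)//.
by have [xz|] := eqVneq x z; [rewrite -xz eq_sym (negPf xy)|case: (y == z)].
Qed.
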